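(* Let $n\ge 3$ and let two regular $n$-gons be given in the Euclidean plane, with centers $O_1,O_2$ and circumradii $R_1,R_2$ respectively. There exist $n$ concentric circles such that each circle passes through one vertex of each of the two polygons if and only if the following two conditions are satisfied: (I) the auxiliary circles of the two polygons, i.e. the circle with center $O_1$ and radius $R_2$ and the circle with center $O_2$ and radius $R_1$, have a common point of intersection; (II) the distances from this point of intersection to one pair of vertices, one from each polygon, are equal.
   Context: For two given regular $n$-gons, an auxiliary circle is a circle whose center coincides with the center of one of the polygons and whose radius equals the radius of the circle circumscribed about the other polygon; thus there are two auxiliary circles. Convention: circles are counted with multiplicity. The existence of $n$ concentric circles, each passing through one vertex of each polygon, means that there is a point $M$ (the common center) such that the list of distances $d_1,\dots,d_n$ from $M$ to the vertices of the first polygon coincides, as a multiset, with the list of distances from $M$ to the vertices of the second polygon; the radii of the circles are $d_1,\dots,d_n$.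
   Formalization: The two polygons are assumed to have different circumradii or the same center: for congruent polygons with distinct centers the ''only if'' part can fail, e.g. two far-apart unit squares translated along a diagonal, whose auxiliary circles are disjoint. *)

(* Defs.v *)
From mathcomp Require Import all_boot all_order all_algebra.
From mathcomp Require Import all_classical all_reals all_analysis.
Set Implicit Arguments.
Unset Strict Implicit.
Unset Printing Implicit Defensive.
Import Order.TTheory GRing.Theory Num.Theory.
Local Open Scope classical_set_scope.
Local Open Scope ring_scope.

(* Explicit Euclidean distance: the library norm on pairs is the sup norm. *)
Definition euclid_dist (R : realType) (P Q : R * R) : R :=
  Num.sqrt ((P.1 - Q.1) ^+ 2 + (P.2 - Q.2) ^+ 2).

Definition circle (R : realType) (c : R * R) (r : R) : set (R * R) :=
  [set P | euclid_dist P c = r].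

(* [A] lists counterclockwise, from an arbitrary starting vertex, the vertices
   of a regular n-gon; its orientation in the plane is the phase [phi]. *)
Definition regular_ngon (R : realType) (n : nat) (O : R * R) (r : R)
    (A : 'I_n -> R * R) : Prop :=
  0 < r /\
  exists phi : R, forall k : 'I_n,
    A k = (O.1 + r * cos (phi + 2 * pi * k%:R / n%:R),
           O.2 + r * sin (phi + 2 * pi * k%:R / n%:R)).

(* Circles are counted with multiplicity: their radii are the distances from
   the common centre [M], compared as multisets.  A radius may be 0, when [M]
   is a common vertex. *)
Definition concentric_circles_through_vertices (R : realType) (n : nat)
    (A B : 'I_n -> R * R) : Prop :=
  exists M : R * R,
    perm_eq [seq euclid_dist M (A i) | i : 'I_n] [seq euclid_dist M (B i) | i : 'I_n].

(* Main.v *)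
(* Let [L1], [L2] be the distances from a point [M] to the two centres.  The
   squared distances from [M] to the vertices of a regular n-gon of radius [r],
   at distance [L] from its centre, are L^2 + r^2 - 2 L r cos (t + 2 pi k / n).
   For n >= 3 their first two moments are determined by L^2 + r^2 and L^2 r^2,
   so equality of the multisets forces {L1^2, R1^2} = {L2^2, R2^2}: either
   L1 = R2 and L2 = R1, i.e. [M] lies on both auxiliary circles, or R1 = R2.
   Conversely, when L1 = R2 and L2 = R1, one coincidence of distances is an
   equality cos u = cos v; then sin u = sin v or sin u = - sin v, and turning
   both polygons by multiples of 2 pi / n, in the same or in opposite senses,
   matches all the other distances. *)
Require Import Defs.
From mathcomp Require Import all_boot all_order all_algebra.
From mathcomp Require Import all_classical all_reals all_analysis.
From mathcomp Require Import ring lra.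
Set Implicit Arguments.
Unset Strict Implicit.
Unset Printing Implicit Defensive.
Import Order.TTheory GRing.Theory Num.Theory.
Local Open Scope classical_set_scope.
Local Open Scope ring_scope.

(** An injective self-map of a finite type is a bijection, so it only reorders the enumeration. *)
Lemma perm_map_reindex (T : finType) (U : eqType) (f g : T -> U)
    (sigma : T -> T) :
  injective sigma -> (forall x, f x = g (sigma x)) ->
  perm_eq [seq f x | x : T] [seq g x | x : T].
Proof.
move=> inj fg; rewrite /image_mem (eq_map fg) map_comp; apply: perm_map.
apply: uniq_perm; rewrite ?map_inj_uniq -?enumT ?enum_uniq // => x.
by rewrite !mem_enum; apply/mapP; exists (invF inj x); rewrite ?mem_enum ?f_invF.
Qed.

Lemma sum_perm_image (V : nmodType) (T : finType) (U : eqType) (f g : T -> U)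
    (F : U -> V) :
  perm_eq [seq f x | x : T] [seq g x | x : T] ->
  \sum_x F (f x) = \sum_x F (g x).
Proof.
move=> fg; have : \sum_(u <- [seq f x | x : T]) F u =
    \sum_(u <- [seq g x | x : T]) F u by apply: perm_big.
by rewrite !big_image.
Qed.

Section Turns.
Variable R : realType.
Implicit Types (n k : nat) (x t s : R) (w : R * R).

Definition turn n k : R := 2 * pi * k%:R / n%:R.

Lemma turnD n j k : turn n (j + k) = turn n j + turn n k.
Proof. by rewrite /turn natrD mulrDr mulrDl. Qed.

Lemma turn_full n : (0 < n)%N -> turn n n = pi *+ 2.
Proof. by move=> n0; rewrite /turn mulfK ?mulr_natl // pnatr_eq0 -lt0n. Qed.

Lemma turnM n q : (0 < n)%N -> turn n (q * n) = pi *+ 2 *+ q.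
Proof.
by move=> n0; rewrite -(turn_full n0) -[RHS]mulr_natl /turn natrM; ring.
Qed.

Lemma sum_cos_turn n m x : (0 < m < n)%N ->
  \sum_(k < n) cos (x + turn n (m * k)) = 0.
(* Multiplied by [2 sin (pi m / n)], the sum telescopes. *)
Proof.
move=> /andP[m0 mn]; have n0 : (0 < n)%N by apply: leq_ltn_trans mn.
have nR : n%:R != 0 :> R by rewrite pnatr_eq0 -lt0n.
pose h : R := pi * m%:R / n%:R.
have h0 : sin h != 0.
  rewrite gt_eqF // sin_gt0_pi // /h -mulrA; apply/andP; split.
    by rewrite mulr_gt0 ?pi_gt0 ?divr_gt0 ?ltr0n.
  by rewrite gtr_pMr ?pi_gt0 // ltr_pdivrMr ?ltr0n // mul1r ltr_nat.
pose f k : R := sin (x + turn n (m * k) - h).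
have turnS k : turn n (m * k.+1) = turn n (m * k) + (h + h).
  by rewrite mulnS addnC turnD /turn /h; congr (_ + _); ring.
apply: (mulfI (x := 2 * sin h)); first by rewrite mulf_neq0 // pnatr_eq0.
rewrite mulr0 mulr_sumr.
rewrite -(big_mkord xpredT (fun k => 2 * sin h * cos (x + turn n (m * k)))).
rewrite (telescope_sumr_eq f) //.
  (* The arguments of [sin] at the two ends differ by [m] full turns. *)
  rewrite /f muln0 {2}/turn mulr0 mul0r addr0 addrAC.
  rewrite turnM // periodicn ?subrr //; exact: sinD2pi.
move=> k _; rewrite /f turnS.
have -> : x + (turn n (m * k) + (h + h)) - h = x + turn n (m * k) + h by ring.
rewrite sinD sinB; ring.
Qed.

Lemma mulr_cos2Dsin2 x t : x * (cos t ^+ 2 + sin t ^+ 2) = x.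
Proof. by rewrite cos2Dsin2 mulr1. Qed.

(** Stands for the term [L r cos] without a polar angle of the point, so that [L = 0] is no special
    case. *)
Definition proj w t : R := w.1 * cos t + w.2 * sin t.

Lemma proj_add w t s :
  proj w (t + s) = proj w t * cos s + proj w (t + pi / 2) * sin s.
Proof. by rewrite /proj cosD sinD cosDpihalf sinDpihalf; ring. Qed.

Lemma proj_sub w t s :
  proj w (t - s) = proj w t * cos s - proj w (t + pi / 2) * sin s.
Proof. by rewrite proj_add cosN sinN mulrN. Qed.

Lemma proj_pythagoras w t :
  proj w t ^+ 2 + proj w (t + pi / 2) ^+ 2 = w.1 ^+ 2 + w.2 ^+ 2.
Proof.
rewrite /proj cosDpihalf sinDpihalf -[RHS](mulr_cos2Dsin2 _ t); ring.
Qed.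

Lemma proj_periodic w : periodic (proj w) (pi *+ 2).
Proof. by move=> t; rewrite /proj cosD2pi sinD2pi. Qed.

Lemma proj_turn_mod n w x k : (0 < n)%N ->
  proj w (x + turn n (k %% n)) = proj w (x + turn n k).
Proof.
move=> n0; rewrite {2}(divn_eq k n) addnC turnD turnM // addrA.
by rewrite periodicn //; exact: proj_periodic.
Qed.

(** Addition in ['I_n.+1] is modulo [n.+1], which matches the period of the turns. *)
Lemma proj_turnD n w x (a b : 'I_n.+1) :
  proj w (x + turn n.+1 (a + b)%R) = proj w (x + turn n.+1 a + turn n.+1 b).
Proof. by rewrite /= proj_turn_mod // turnD addrA. Qed.

Lemma proj_turnB n w x (a b : 'I_n.+1) :
  proj w (x + turn n.+1 (a - b)%R) = proj w (x + turn n.+1 a - turn n.+1 b).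
Proof.
have nb : turn n.+1 (n.+1 - b) = pi *+ 2 - turn n.+1 b.
  apply/eqP; rewrite -(turn_full (ltn0Sn n)) eq_sym subr_eq -turnD subnK //.
  exact/ltnW.
rewrite /= modnDmr proj_turn_mod // turnD nb -[RHS](proj_periodic w).
by congr proj; ring.
Qed.

Lemma sum_proj n w x : (2 <= n)%N -> \sum_(k < n) proj w (x + turn n k) = 0.
Proof.
move=> n2; have z y : \sum_(k < n) cos (y + turn n k) = 0.
  by rewrite -[RHS](@sum_cos_turn n 1 y) //; apply: eq_bigr => k _; rewrite mul1n.
rewrite big_split /= -!mulr_sumr z.
under [X in _ + _ * X]eq_bigr do rewrite -cosBpihalf addrAC.
by rewrite z !mulr0 addr0.
Qed.

Lemma sum_proj_sqr n w x : (3 <= n)%N ->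
  \sum_(k < n) proj w (x + turn n k) ^+ 2 = n%:R / 2 * (w.1 ^+ 2 + w.2 ^+ 2).
Proof.
(* Squaring doubles the angle; the oscillating sums then vanish because [2 < n]. *)
move=> n3; have z y := @sum_cos_turn n 2 y n3.
have E t : proj w t ^+ 2 = (w.1 ^+ 2 + w.2 ^+ 2) / 2 +
  (w.1 ^+ 2 - w.2 ^+ 2) / 2 * cos (t + t) + w.1 * w.2 * cos (t + t - pi / 2).
  rewrite cosBpihalf sinD cosD /proj -[X in X + _ + _](mulr_cos2Dsin2 _ t).
  by field.
under eq_bigr do rewrite E.
rewrite !big_split /= -!mulr_sumr sumr_const card_ord.
have dbl k : x + turn n k + (x + turn n k) = x + x + turn n (2 * k).
  by rewrite mul2n -addnn turnD; ring.
under eq_bigr do rewrite dbl.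
rewrite z.
under eq_bigr do rewrite dbl addrAC.
rewrite z !mulr0 !addr0 -mulr_natl; ring.
Qed.

Lemma proj_reindex n w w' x y (i j : 'I_n) :
    w.1 ^+ 2 + w.2 ^+ 2 = w'.1 ^+ 2 + w'.2 ^+ 2 ->
    proj w (x + turn n i) = proj w' (y + turn n j) ->
  exists2 sigma : 'I_n -> 'I_n, injective sigma &
    forall k : 'I_n, proj w (x + turn n k) = proj w' (y + turn n (sigma k)).
Proof.
case: n i j => [[]//|n] i j nrm e.
(* The components at right angles, in the role of the sines, agree up to sign by Pythagoras. Equal
   signs give a rotation of the indices, opposite signs a reflection. *)
have : proj w (x + turn n.+1 i + pi / 2) ^+ 2 =
       proj w' (y + turn n.+1 j + pi / 2) ^+ 2.
  have := nrm; rewrite -(proj_pythagoras w (x + turn n.+1 i)).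
  by rewrite -(proj_pythagoras w' (y + turn n.+1 j)) e => /addrI.
move/eqP; rewrite eqf_sqr => /orP[] /eqP e'.
- exists (fun k : 'I_n.+1 => j + (k - i)) => [k l /addrI/addIr//|k].
  rewrite -{1}(subrKC i k); move: (k - i) => d.
  rewrite !proj_turnD [LHS]proj_add [RHS]proj_add.
  by rewrite e e'.
- exists (fun k : 'I_n.+1 => j - (k - i)) => [k l /addrI/oppr_inj/addIr//|k].
  rewrite -{1}(subrKC i k); move: (k - i) => d.
  rewrite proj_turnB proj_turnD [LHS]proj_add [RHS]proj_sub.
  by rewrite e e' mulNr.
Qed.

End Turns.

Section Distances.
Variable R : realType.
Implicit Types (O P M : R * R).

Lemma euclid_dist_ge0 P M : 0 <= euclid_dist P M.
Proof. exact: sqrtr_ge0. Qed.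

Lemma euclid_dist_sqr P M :
  euclid_dist P M ^+ 2 = (P.1 - M.1) ^+ 2 + (P.2 - M.2) ^+ 2.
Proof. by rewrite sqr_sqrtr // addr_ge0 ?sqr_ge0. Qed.

Lemma euclid_dist_eq P M P' M' :
  euclid_dist P M ^+ 2 = euclid_dist P' M' ^+ 2 ->
  euclid_dist P M = euclid_dist P' M'.
Proof. by move/eqP; rewrite eqrXn2 ?euclid_dist_ge0 // => /eqP. Qed.

Variables (n : nat) (O : R * R) (r phi : R) (A : 'I_n -> R * R).
Hypothesis A_def : forall k : 'I_n,
  A k = (O.1 + r * cos (phi + 2 * pi * k%:R / n%:R),
         O.2 + r * sin (phi + 2 * pi * k%:R / n%:R)).

(** With the factor [r], a point on both auxiliary circles has two offsets of the same norm
    [R1 * R2], as [proj_reindex] requires. *)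
Definition scaled_offset M : R * R := (r * (M.1 - O.1), r * (M.2 - O.2)).

Lemma scaled_offset_sqr M :
  (scaled_offset M).1 ^+ 2 + (scaled_offset M).2 ^+ 2 =
  r ^+ 2 * euclid_dist M O ^+ 2.
Proof. by rewrite euclid_dist_sqr /=; ring. Qed.

Lemma dist_vertex_sqr M k :
  euclid_dist M (A k) ^+ 2 = euclid_dist M O ^+ 2 + r ^+ 2
    - 2 * proj (scaled_offset M) (phi + turn R n k).
Proof.
rewrite !euclid_dist_sqr A_def /proj /turn /= 
  -[r ^+ 2](mulr_cos2Dsin2 _ (phi + 2 * pi * k%:R / n%:R)).
by ring.
Qed.

Lemma sum_dist_vertex2 M : (2 <= n)%N ->
  \sum_(k < n) euclid_dist M (A k) ^+ 2 =
  n%:R * (euclid_dist M O ^+ 2 + r ^+ 2).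
Proof.
move=> n2; under eq_bigr do rewrite dist_vertex_sqr.
rewrite sumrB -mulr_sumr sum_proj // mulr0 subr0.
by rewrite sumr_const card_ord mulr_natl.
Qed.

Lemma sum_dist_vertex4 M : (3 <= n)%N ->
  \sum_(k < n) (euclid_dist M (A k) ^+ 2) ^+ 2 =
  n%:R * ((euclid_dist M O ^+ 2 + r ^+ 2) ^+ 2
          + 2 * (r ^+ 2 * euclid_dist M O ^+ 2)).
Proof.
move=> n3; set S := _ + r ^+ 2.
have E k : (euclid_dist M (A k) ^+ 2) ^+ 2 = S ^+ 2
    - 4 * S * proj (scaled_offset M) (phi + turn R n k)
    + 4 * proj (scaled_offset M) (phi + turn R n k) ^+ 2.
  by rewrite dist_vertex_sqr -/S; ring.
under eq_bigr do rewrite E.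
rewrite big_split sumrB /= -!mulr_sumr sum_proj ?(ltnW n3) // sum_proj_sqr //.
by rewrite scaled_offset_sqr sumr_const card_ord -[_ *+ n]mulr_natl; field.
Qed.

End Distances.

(* The hypothesis [R1 <> R2 \/ O1 = O2] excludes exactly the congruent polygons
   with distinct centres, for which the equivalence can fail: two unit squares
   that are far translates of each other along a side direction are mirror
   images in the perpendicular bisector of [O1 O2], every point of which is
   equidistant from both vertex lists, but their auxiliary circles are
   disjoint. *)
Theorem theorem2p1 (R : realType) (n : nat) (O1 O2 : R * R) (R1 R2 : R)
    (A B : 'I_n -> R * R)
    (n_ge3 : (3 <= n)%N)
    (regA : regular_ngon O1 R1 A) (regB : regular_ngon O2 R2 B)
    (noncongruent_or_concentric : R1 <> R2 \/ O1 = O2) :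
  concentric_circles_through_vertices A B <->
  exists P : R * R,
    (circle O1 R2 `&` circle O2 R1) P /\
    exists i j : 'I_n, euclid_dist P (A i) = euclid_dist P (B j).
Proof.
case: regA regB => r10 [phi Adef] [r20 [psi Bdef]].
have n_gt0 : (0 < n)%N by apply: leq_trans n_ge3.
have n_neq0 : n%:R != 0 :> R by rewrite pnatr_eq0 -lt0n.
pose i0 := Ordinal n_gt0.
split=> [[M AB]|[P [[PO1 PO2] [i [j e]]]]]; last first.
  exists P.
  have [||sigma inj E] := @proj_reindex R n (scaled_offset O1 R1 P)
     (scaled_offset O2 R2 P) phi psi i j.
  - by rewrite scaled_offset_sqr scaled_offset_sqr PO1 PO2 mulrC.
  - move/(congr1 (fun z => z ^+ 2)): e.
    rewrite (dist_vertex_sqr Adef) (dist_vertex_sqr Bdef) PO1 PO2; lra.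
  apply: (perm_map_reindex inj) => k; apply: euclid_dist_eq.
  by rewrite (dist_vertex_sqr Adef) (dist_vertex_sqr Bdef) PO1 PO2 E; ring.
have sumE : euclid_dist M O1 ^+ 2 + R1 ^+ 2 = euclid_dist M O2 ^+ 2 + R2 ^+ 2.
  apply: (mulfI n_neq0).
  rewrite -(sum_dist_vertex2 Adef) ?(ltnW n_ge3) //.
  rewrite -(sum_dist_vertex2 Bdef) ?(ltnW n_ge3) //.
  exact: (sum_perm_image (fun z => z ^+ 2) AB).
have prodE : R1 ^+ 2 * euclid_dist M O1 ^+ 2 = R2 ^+ 2 * euclid_dist M O2 ^+ 2.
  have := sum_perm_image (fun z => (z ^+ 2) ^+ 2) AB.
  rewrite (sum_dist_vertex4 Adef) // (sum_dist_vertex4 Bdef) // => /(mulfI n_neq0).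
  by rewrite sumE => /addrI/mulfI; apply; rewrite pnatr_eq0.
(* By [sumE] and [prodE], [R1 ^+ 2] is a root of the monic quadratic with roots [R2 ^+ 2] and
   [euclid_dist M O2 ^+ 2]. *)
have : (R1 ^+ 2 - R2 ^+ 2) * (R1 ^+ 2 - euclid_dist M O2 ^+ 2) = 0.
  rewrite mulrBl !mulrBr -prodE; transitivity
    (R1 ^+ 2 * (euclid_dist M O1 ^+ 2 + R1 ^+ 2 - (euclid_dist M O2 ^+ 2 + R2 ^+ 2))).
    by ring.
  by rewrite sumE subrr mulr0.
move/eqP; rewrite mulf_eq0 !subr_eq0 => /orP[] /eqP sqrE.
  have RE : R1 = R2 by apply/eqP; rewrite -(@eqrXn2 _ 2) ?ltW // sqrE.
  have OE : O1 = O2 by case: noncongruent_or_concentric.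
  (* Concentric congruent polygons: take [P] on their common circumcircle, on
     the bisector of the angle between one vertex of each. *)
  pose a := phi + 2 * pi * i0%:R / n%:R; pose b := psi + 2 * pi * i0%:R / n%:R.
  pose t := (a + b) / 2.
  pose P := (O1.1 + R1 * cos t, O1.2 + R1 * sin t).
  have dP : euclid_dist P O1 = R1.
    apply/eqP; rewrite -(@eqrXn2 _ 2) ?euclid_dist_ge0 ?ltW //.
    rewrite euclid_dist_sqr /P /= -[eqbRHS](mulr_cos2Dsin2 _ t).
    by apply/eqP; ring.
  exists P; split; first by split; rewrite /circle /= -?OE -?RE.
  exists i0, i0; apply: euclid_dist_eq.
  rewrite (dist_vertex_sqr Adef) (dist_vertex_sqr Bdef) -OE -RE; congr (_ - _ * _).
  rewrite /proj /P /turn /= -/a -/b.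
  have pE s : R1 * (O1.1 + R1 * cos t - O1.1) * cos s +
      R1 * (O1.2 + R1 * sin t - O1.2) * sin s = R1 ^+ 2 * cos (t - s).
    by rewrite cosB; ring.
  by rewrite !pE -cosN; congr (_ * cos _); rewrite /t; field.
(* In the remaining case [M] itself is the required common point. *)
have R1E : euclid_dist M O2 = R1.
  by apply/eqP; rewrite -(@eqrXn2 _ 2) ?euclid_dist_ge0 ?ltW // sqrE.
exists M; split; first split=> //=.
  apply/eqP; rewrite -(@eqrXn2 _ 2) ?euclid_dist_ge0 ?ltW //.
  by apply/eqP; move: sumE; rewrite sqrE addrC => /addrI.
have : euclid_dist M (A i0) \in [seq euclid_dist M (B i) | i : 'I_n].
  by rewrite -(perm_mem AB) (fintype.image_f (fun i => euclid_dist M (A i))).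
by case/fintype.imageP => j _ e; exists i0, j.
Qed.
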